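(* Let $T$ be a finite tree and let $S\neq\emptyset$ be a proper subtree of $T$. Then $$D_T(S)\ge \frac12,$$ with equality if and only if $S\supseteq T^*$, where $T^*$ is the core of $T$.
   Context: A (nonempty) subtree of a tree $T$ is a nonempty connected subgraph; $|T|$ denotes the number of vertices of $T$. For a subtree $S\subseteq T$, let $N_T(S)$ be the number of subtrees of $T$ containing $S$ and $R_T(S)$ the sum of the orders (numbers of vertices) of all subtrees of $T$ containing $S$. The local mean at $S$ is $\mu_T(S)=R_T(S)/N_T(S)$. For a proper subtree $S\subsetneq T$ with $|T|=n$ and $|S|=k$, the local density at $S$ is $D_T(S)=\dfrac{\mu_T(S)-k}{n-k}$. A limb of $T$ is a maximal path in $T$ consisting of a leaf of $T$ and vertices of degree $2$ in $T$ (so if $T$ is not a path, a limb consists of a leaf together with all degree-$2$ vertices on the way from it up to, but not including, the first vertex of degree at least $3$; if $T$ is a path, all of $T$ is a limb). The core $T^*$ of $T$ is what remains of $T$ after removing all vertices of all limbs; in particular $T^*=\emptyset$ if $T$ is a path, and $T^*$ is a subtree of $T$ otherwise. *)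

(* Defs.v *)
From mathcomp Require Import all_boot all_order all_algebra.

Set Implicit Arguments.
Unset Strict Implicit.
Unset Printing Implicit Defensive.

Import Order.TTheory GRing.Theory Num.Theory.
Local Open Scope ring_scope.

Section Trees.
Variables (V : finType) (e : rel V).

(* An edge walked back and forth is a ucycle on two vertices, so acyclicity only
   excludes those on three vertices or more. *)
Definition is_tree : Prop :=
  [/\ (0 < #|V|)%N, symmetric e, irreflexive e,
      forall x y, connect e x y
    & forall x p, ucycle e (x :: p) -> (size p < 2)%N].

Definition edges : {set {set V}} := [set [set x; y] | x in V, y in e x].

(* A graph is its vertex set paired with its edge set; an edge is the
   two-element set of its ends. *)
Definition graph : finType := ({set V} * {set {set V}})%type.

Definition whole : graph := ([set: V], edges).

Definition induced (A : {set V}) : graph := (A, [set f in edges | f \subset A]).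

Definition sub_graph (H K : graph) : bool :=
  (H.1 \subset K.1) && (H.2 \subset K.2).

Definition is_subgraph (H : graph) : bool :=
  sub_graph H whole && [forall f in H.2, f \subset H.1].

Definition adj (H : graph) : rel V := fun x y => [set x; y] \in H.2.

Definition connected (H : graph) : bool :=
  [forall x in H.1, forall y in H.1, connect (adj H) x y].

Definition subtree (H : graph) : bool :=
  [&& is_subgraph H, H.1 != set0 & connected H].

Definition graph_order (H : graph) : nat := #|H.1|.

Definition subtrees_containing (S : graph) : {set graph} :=
  [set H | subtree H & sub_graph S H].

Definition subtree_number (S : graph) : nat := #|subtrees_containing S|.

Definition subtree_order_sum (S : graph) : nat :=
  (\sum_(H in subtrees_containing S) graph_order H)%N.

Definition local_mean (S : graph) : rat :=
  (subtree_order_sum S)%:R / (subtree_number S)%:R.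

Definition local_density (S : graph) : rat :=
  (local_mean S - (graph_order S)%:R)
    / ((graph_order whole)%:R - (graph_order S)%:R).

Definition degree (x : V) : nat := #|[set y | e x y]|.

(* The vertex of the one-vertex tree, which is a path, counts as a leaf. *)
Definition leaf (x : V) : bool := (degree x <= 1)%N.

Definition path_graph (x : V) (s : seq V) : graph :=
  ([set:: x :: s], [set:: pairmap (fun y z => [set y; z]) x s]).

(* The bound on the length n is no restriction: the n.+1 vertices of the path
   are pairwise distinct. *)
Definition is_path (P : graph) : bool :=
  [exists n : 'I_#|V|, exists x : V, exists s : n.-tuple V,
    [&& uniq (x :: s), path e x s & P == path_graph x s]].

(* Two leaves are allowed, since the whole tree is a limb when it is a path;
   in any other tree such a path has exactly one leaf. *)
Definition leaf_path (P : graph) : bool :=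
  [&& is_path P, [exists x in P.1, leaf x]
    & [forall x in P.1, leaf x || (degree x == 2)]].

Definition limb (P : graph) : bool :=
  leaf_path P && [forall Q, leaf_path Q ==> sub_graph P Q ==> (Q == P)].

Definition core : graph :=
  induced [set x | [forall P, limb P ==> (x \notin P.1)]].

End Trees.

(* Main.v *)
Require Import Defs.
From mathcomp Require Import all_boot all_order all_algebra.
From mathcomp Require Import ring.

(** Root the tree at a vertex s of S and let x <= y mean that every walk from s
to y meets x.  The subtrees containing S are then the down-sets A containing
S, each determined by its vertex set.  Clearing denominators, D_T(S) >= 1/2
says that, summed over these A, the number of vertices outside A is at most
the number of vertices of A outside S.  So it suffices to inject the pairs
(A, v) with v outside A into the pairs (A', w) with w in A' but not in S.

The injection ([complete]) adds to A the whole path from the root to v, and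
remembers the first vertex w of that path outside A.  Nothing of A lies above
w, so the part of A' above w is exactly the path from w to v: its top is v,
and deleting it from A' gives back A.  Hence the pairs (A', w) that are reached
are those for which the part of A' above w is a chain.  Taking A' to be the
whole tree, all pairs are reached if and only if the vertices above w form a
chain for every w outside S ([missing_leqif_extra]).

This uses only that the vertices below a given one form a chain.  That holds
for domination in any connected graph; acyclicity is what makes every vertex
of a simple path from the root lie below its end ([path_dom]), and hence
makes down-sets connected.

Finally, a vertex w outside S has exactly one neighbour which is not above it,
and its other neighbours are pairwise incomparable.  So the chain condition at
all w outside S means that all these w have degree at most 2
([chain_iff_degree]), and then the path from w to the top of its chain ends in
a leaf, which puts w in a limb; conversely the vertices of limbs have degree at
most 2 ([core_sub_iff]).  So equality holds exactly when S contains the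
core. *)

Set Implicit Arguments.
Unset Strict Implicit.
Unset Printing Implicit Defensive.

Import Order.TTheory GRing.Theory Num.Theory.

(** * Down-sets of a forest order *)

Section DownSets.
Variables (V : finType) (le : rel V) (S : {set V}).
Hypothesis le_refl : reflexive le.
Hypothesis le_anti : antisymmetric le.
Hypothesis le_trans : transitive le.
Hypothesis le_forest : forall z x y, le x z -> le y z -> le x y || le y x.

Definition downset (A : {set V}) := [forall x in A, forall y, le y x ==> (y \in A)].
Definition chain_above w :=
  [forall x, forall y, le w x ==> le w y ==> (le x y || le y x)].
Definition downsets_containing := [set A : {set V} | (S \subset A) && downset A].

Lemma downsetP (A : {set V}) :
  reflect (forall x y, x \in A -> le y x -> y \in A) (downset A).
Proof.
apply: (iffP forall_inP) => [dA x y xA yx|dA x xA].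
  by have /forallP/(_ y)/implyP := dA x xA; apply.
by apply/forallP => y; apply/implyP; apply: dA xA.
Qed.

Lemma chain_aboveP w :
  reflect (forall x y, le w x -> le w y -> le x y || le y x) (chain_above w).
Proof.
apply: (iffP forallP) => [ch x y wx wy|ch x].
  by have /forallP/(_ y) := ch x; rewrite wx wy.
by apply/forallP => y; apply/implyP => wx; apply/implyP => wy; apply: ch.
Qed.

Hypothesis downS : downset S.
Local Notation F := downsets_containing.

(** For v outside a down-set A, the points of A below v form an initial segment
of the chain below v; this is the first point after that segment.  On a chain,
minimal points are those with the fewest points below them. *)
Definition entry (A : {set V}) v :=
  [arg min_(w < v | le w v && (w \notin A)) #|[set x | le x w]|].

Lemma entryP (A : {set V}) v : v \notin A ->
  [/\ le (entry A v) v, entry A v \notin A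
    & forall z, le z v -> z \notin A -> le (entry A v) z].
Proof.
move=> vA; rewrite /entry; case: arg_minnP => [|w /andP[wv wA] wmin].
  by rewrite le_refl.
split=> // z zv zA; case/orP: (le_forest wv zv) => // zw.
have sub : [set x | le x z] \subset [set x | le x w].
  by apply/subsetP => x; rewrite !inE => /le_trans; apply.
have : [set x | le x z] == [set x | le x w].
  by rewrite eqEcard sub wmin // zv.
by move/eqP/setP/(_ w); rewrite !inE le_refl.
Qed.

Lemma entry_uniq (A : {set V}) v w : v \notin A -> le w v -> w \notin A ->
  (forall z, le z v -> z \notin A -> le w z) -> entry A v = w.
Proof.
move=> vA wv wA wmin; have [ev eA emin] := entryP vA.
by apply: le_anti; rewrite emin ?wmin.
Qed.

Definition missing := [set u : {set V} * V | (u.1 \in F) && (u.2 \notin u.1)].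
Definition extra := [set u : {set V} * V | (u.1 \in F) && (u.2 \in u.1 :\: S)].

(** This is injective on [missing] because the part of the new down-set above
the remembered point is the segment from that point to v: its top is v, and
removing it restores A. *)
Definition complete (u : {set V} * V) := (u.1 :|: [set x | le x u.2], entry u.1 u.2).

Lemma complete_extra u : u \in missing -> complete u \in extra.
Proof.
case: u => A v; rewrite !inE /= => /andP[/andP[SA /downsetP dA] vA].
have [ev eA _] := entryP vA.
rewrite (subset_trans SA (subsetUl _ _)) ev orbT andbT /=; apply/andP; split.
  apply/downsetP => x y; rewrite !inE => /orP[xA yx|xv /le_trans->//].
    by rewrite (dA x).
  by rewrite orbT.
by apply: contra eA; apply: (subsetP SA).
Qed.

Lemma complete_above u x : u \in missing ->
  le (complete u).2 x -> (x \in (complete u).1) = le x u.2.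
Proof.
case: u => A v; rewrite !inE /= => /andP[/andP[_ /downsetP dA] vA] wx.
have [_ eA _] := entryP vA; case xA: (x \in A) => //=.
by case/negP: eA; apply: dA wx.
Qed.

Lemma complete_fst u : u \in missing ->
  u.1 = (complete u).1 :\: [set x | le (complete u).2 x].
Proof.
case: u => A v; rewrite !inE /= => /andP[/andP[_ /downsetP dA] vA].
have [_ eA emin] := entryP vA; apply/setP => x; rewrite !inE.
have [xA|xA /=] := boolP (x \in A); rewrite ?andbT ?andbF.
  by apply/esym; apply: contra eA; apply: dA.
case xv: (le x v); rewrite ?andbF // andbT.
by rewrite emin.
Qed.

Lemma complete_inj : {in missing &, injective complete}.
Proof.
move=> u u' uX uX' eq_c.
have eq1 : u.1 = u'.1 by rewrite (complete_fst uX) (complete_fst uX') eq_c.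
have top t : t \in missing -> le (complete t).2 t.2.
  by case: t => A v; rewrite !inE /= => /andP[_ /entryP[]].
have eq2 : u.2 = u'.2.
  apply: le_anti; rewrite -(complete_above uX') -?eq_c ?top //.
  by rewrite (complete_above uX) ?top // le_refl -(complete_above uX) ?eq_c
     ?(complete_above uX') ?top ?le_refl.
by case: u u' eq1 eq2 {uX uX' eq_c} => A v [A' v'] /= -> ->.
Qed.

Lemma chain_max (B : {set V}) w : chain_above w -> w \in B ->
  exists v, [/\ v \in B, le w v & forall x, x \in B -> le w x -> le x v].
Proof.
move=> /chain_aboveP ch wB.
have [|v /andP[vB wv] vmax] :=
  @arg_maxnP _ w (fun v => (v \in B) && le w v) (fun v => #|[set x | le x v]|).
  by rewrite wB le_refl.
exists v; split=> // x xB wx; case/orP: (ch _ _ wv wx) => // vx.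
have sub : [set y | le y v] \subset [set y | le y x].
  by apply/subsetP => y; rewrite !inE => /le_trans; apply.
have : [set y | le y v] == [set y | le y x].
  by rewrite eqEcard sub; apply: vmax; rewrite xB.
by move/eqP/setP/(_ x); rewrite !inE le_refl.
Qed.

(** A pair (A, w) whose part of A above w is a chain with top v is the image of
(A minus that part, v).  Conversely, if the pair made of the whole set and w is
the image of (A, v), everything above w is below v, hence is a chain. *)
Lemma complete_onto :
  (complete @: missing == extra) = [forall w in ~: S, chain_above w].
Proof.
apply/eqP/forall_inP => [onto w|chains].
  rewrite inE => wS; have : ([set: V], w) \in extra.
    by rewrite !inE wS subsetT /= andbT; apply/downsetP => ? ? _ _; rewrite inE.
  rewrite -onto => /imsetP[u uX eq_c].
  apply/chain_aboveP => x y wx wy.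
  have := complete_above (x := x) uX; have := complete_above (x := y) uX.
  by rewrite -eq_c !inE => /(_ wy) yu /(_ wx) xu; apply: (@le_forest u.2).
apply/eqP; rewrite eqEsubset; apply/andP; split.
  by apply/subsetP => _ /imsetP[u uX ->]; apply: complete_extra.
apply/subsetP => -[A w]; rewrite !inE /= -andbA => /and4P[SA /downsetP dA wS wA].
have [|v [vA wv vmax]] := chain_max (chains w _) wA; first by rewrite inE.
have vX : v \notin A :\: [set x | le w x] by rewrite !inE wv.
apply/imsetP; exists (A :\: [set x | le w x], v).
  rewrite inE vX inE andbT /=; apply/andP; split.
    apply/subsetP => x xS; rewrite !inE (subsetP SA) // andbT.
    by apply: contra wS; apply: (downsetP _ downS).
  apply/downsetP => x y; rewrite !inE => /andP[wx xA] yx; rewrite (dA x) // andbT.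
  by apply: contra wx => /le_trans; apply.
rewrite /complete /=; congr pair; last first.
  rewrite (@entry_uniq _ _ w) // ?inE ?le_refl // => z zv.
  by rewrite !inE (dA v) // andbT negbK.
apply/setP => x; rewrite !inE; apply/idP/orP => [xA|[/andP[]//|xv]]; last first.
  exact: dA xv.
by rewrite xA andbT; case wx: (le w x); [right; apply: vmax|left].
Qed.

Lemma card_pairs (P : {set V} -> {set V}) :
  #|[set u : {set V} * V | (u.1 \in F) && (u.2 \in P u.1)]| =
  \sum_(A in F) #|P A|.
Proof.
rewrite -sum1_card (eq_bigl (fun u => (u.1 \in F) && (u.2 \in P u.1))); last first.
  by move=> u; rewrite inE.
rewrite -(pair_big_dep (fun A => A \in F) (fun A x => x \in P A) (fun _ _ => 1)) /=.
by apply: eq_bigr => A _; rewrite sum1_card.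
Qed.

(** Double counting: both sums count pairs, and [complete] injects the pairs of
the left one into those of the right one. *)
Lemma missing_leqif_extra :
  \sum_(A in F) #|~: A| <= \sum_(A in F) #|A :\: S|
    ?= iff [forall w in ~: S, chain_above w].
Proof.
have <- : #|missing| = \sum_(A in F) #|~: A|.
  by rewrite -card_pairs; apply: eq_card => u; rewrite !inE.
have <- : #|extra| = \sum_(A in F) #|A :\: S| by rewrite -card_pairs.
rewrite -complete_onto -(card_in_imset complete_inj).
apply: subset_leqif_cards.
by apply/subsetP => _ /imsetP[u uX ->]; apply: complete_extra.
Qed.

End DownSets.

(** * Domination in a rooted tree *)

Section Dominance.
Variables (V : finType) (e : rel V).
Hypothesis treeT : is_tree e.

Definition avoid x : rel V := [rel a b | [&& e a b, a != x & b != x]].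

(** Every walk from s to y meets x.  The disjunct x = y is needed for x = y = s
only, since the empty walk uses no edge at s. *)
Definition dom s x y := (x == y) || ~~ connect (avoid x) s y.

Let e_sym : symmetric e. Proof. by case: treeT. Qed.
Let e_irr : irreflexive e. Proof. by case: treeT. Qed.

Lemma avoid_sym x : symmetric (avoid x).
Proof. by move=> a b; rewrite /avoid /= e_sym [(a != x) && _]andbC. Qed.

Lemma avoid_connect x u p : path e u p -> x \notin u :: p ->
  connect (avoid x) u (last u p).
Proof.
move=> up xp; apply/connectP; exists p => //; elim: p u up xp => //= v p IHp u.
case/andP=> uv vp; rewrite inE negb_or eq_sym => /andP[xu xp].
rewrite /avoid /= uv xu IHp // andbT /=.
by move: xp; rewrite inE negb_or eq_sym => /andP[].
Qed.

Lemma avoid_path x u p : path (avoid x) u p -> path e u p /\ x \notin p.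
Proof.
elim: p u => //= v p IHp u /andP[/and3P[uv _ vx] /IHp[vp xp]].
by rewrite uv vp inE negb_or eq_sym vx xp.
Qed.

Lemma domP s x y :
  reflect (forall p, path e s p -> last s p = y -> x \in s :: p) (dom s x y).
Proof.
apply: (iffP orP) => [[/eqP-> p _ <-|xy p sp py]|walks].
- exact: mem_last.
- by apply: contraR xy => xp; rewrite -py; apply: avoid_connect.
have [->|xy] := eqVneq x y; [by left | right].
apply/negP => /connectP[p sp py].
have [sp' xp] := avoid_path sp; have := walks p sp' (esym py).
rewrite inE (negbTE xp) orbF => /eqP xs; case: p sp py {sp' xp} => [_ /= ys|v p].
  by rewrite xs ys eqxx in xy.
by rewrite /avoid /= xs eqxx andbF.
Qed.

Lemma simple_path s y :
  exists p, [/\ path e s p, uniq (s :: p) & last s p = y].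
Proof.
have /connectP[p sp ->] : connect e s y by case: treeT.
by case/shortenP: sp => q sq uq _; exists q.
Qed.

Lemma dom_refl s : reflexive (dom s).
Proof. by move=> x; rewrite /dom eqxx. Qed.

Lemma dom_anti s : antisymmetric (dom s).
Proof.
move=> x y /andP[/domP xy /domP yx].
have [p [sp up py]] := simple_path s y; have xp := xy p sp py.
case/splitPl: xp sp up py => p1 p2 px.
rewrite cat_path last_cat px => /andP[sp1 _]; rewrite -cat_cons cat_uniq.
case/and3P=> _ /hasPn disj _ yE; have yp1 := yx p1 sp1 px.
case: p2 yE disj => [//|z p2] yE disj.
have yp2 : y \in z :: p2 by rewrite -yE /= mem_last.
by have := disj y yp2; rewrite yp1.
Qed.

Lemma dom_trans s : transitive (dom s).
Proof.
move=> y x z /domP xy /domP yz; apply/domP => p sp pz.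
have yp := yz p sp pz; case/splitPl: yp sp => p1 p2 py; rewrite cat_path => /andP[sp1 _].
by rewrite -cat_cons mem_cat xy.
Qed.

(** A walk from s to the middle of a simple path, continued along the rest of the
path, meets x; by simplicity the rest does not contain x, so the walk does. *)
Lemma dom_earlier s p1 p2 x : path e s (p1 ++ p2) -> uniq (s :: p1 ++ p2) ->
  x \in s :: p1 -> dom s x (last s (p1 ++ p2)) -> dom s x (last s p1).
Proof.
rewrite cat_path last_cat => /andP[_ pp2]; rewrite -cat_cons cat_uniq.
case/and3P=> _ /hasPn disj _ xp1 /domP xz; apply/domP => q sq qE.
have := xz (q ++ p2); rewrite cat_path last_cat sq qE => /(_ pp2 erefl).
rewrite -cat_cons mem_cat => /orP[//|xp2].
by have := disj x xp2; rewrite xp1.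
Qed.

Lemma dom_forest s z x y : dom s x z -> dom s y z -> dom s x y || dom s y x.
Proof.
move=> xz yz; have [p [sp up pz]] := simple_path s z.
have yp := (domP _ _ _ yz) p sp pz.
have xp := (domP _ _ _ xz) p sp pz.
case/splitPl: xp sp up pz yp => p1 p2 px sp up pz.
rewrite -cat_cons mem_cat; have [yp1 _|_ /= yp2] := boolP (y \in s :: p1).
  by apply/orP; right; rewrite -px; apply: (dom_earlier sp up); rewrite ?pz.
apply/orP; left; have : y \in last s p1 :: p2 by rewrite inE yp2 orbT.
move=> yp; case/splitPl: yp sp up pz {yp2} => p3 p4 py sp up pz.
rewrite catA in sp up pz; rewrite -py -last_cat.
apply: (dom_earlier sp up); last by rewrite pz.
by rewrite -cat_cons mem_cat -px mem_last.
Qed.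

(** This is the only form in which acyclicity is used for domination: a simple
path between distinct a and b avoiding their common neighbour x would close up to a cycle
through x. *)
Lemma branch_uniq x a b : e x a -> e x b -> connect (avoid x) a b -> a = b.
Proof.
move=> xa xb /connectP[p0 ap0]; case/shortenP: ap0 => p ap up _ bE.
have [ap' xp] := avoid_path ap.
have xNa : x != a by apply: contraTneq xa => ->; rewrite e_irr.
case: treeT => _ _ _ _ /(_ x (a :: p)) acyc.
suff : size (a :: p) < 2 by case: p bE {ap ap' up xp acyc} => [->|].
apply: acyc; apply/andP; split; last by rewrite cons_uniq inE negb_or xNa xp.
by rewrite /= xa rcons_path ap' /= -bE e_sym.
Qed.

(** If some walk from s to the end of the path avoided x, then going back to s along
the path, out along that walk and back towards x would join the two neighbours
of x on the path without meeting x. *)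
Lemma path_dom s p x : path e s p -> uniq (s :: p) -> x \in s :: p ->
  dom s x (last s p).
Proof.
move=> sp up xp; apply/domP => q sq qE; apply: contraT => xq.
case/splitPl: xp sp up qE => p1 p2 px; rewrite cat_path last_cat px -cat_cons cat_uniq.
case/andP=> sp1 xp2 /and3P[up1 /hasPn disj up2] qE.
case/lastP: p1 px sp1 up1 disj => [/= sx|p1 x'].
  by rewrite -sx mem_head in xq.
rewrite last_rcons => ->; rewrite rcons_path -rcons_cons rcons_uniq.
case/andP=> sp1 ax /andP[xp1 up1] disj.
case: p2 xp2 disj up2 qE => [_ _ _ qE|b p2 /= /andP[xb bp2] disj up2 qE].
  by case/negP: xq; rewrite -[x]qE mem_last.
have xbp2 : x \notin b :: p2.
  by apply/negP => /disj; rewrite -rcons_cons mem_rcons mem_head.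
have ab : last s p1 = b.
  apply: (@branch_uniq x) => //; first by rewrite e_sym.
  apply: (@connect_trans _ _ s); last first.
    apply: connect_trans (avoid_connect sq xq) _; rewrite qE.
    by rewrite (sym_connect_sym (avoid_sym x)) avoid_connect.
  by rewrite (sym_connect_sym (avoid_sym x)) avoid_connect.
by have /negP[] := disj b (mem_head _ _); rewrite -ab -rcons_cons mem_rcons inE mem_last orbT.
Qed.

(** The neighbour a is the parent of w.  From another neighbour that can be reached
without meeting w, one could return to a through s without meeting w. *)
Lemma parent_ex s w : w != s ->
  exists a, [/\ e w a, ~~ dom s w a & forall b, e w b -> b != a -> dom s w b].
Proof.
move=> ws; have [p [sp up pw]] := simple_path s w.
case/lastP: p sp up pw => [_ _ /= sw|p w']; first by rewrite sw eqxx in ws.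
rewrite last_rcons rcons_path -rcons_cons rcons_uniq.
case/andP=> sp aw /andP[wp _] ww; rewrite {}ww in aw wp.
have wa : e w (last s p) by rewrite e_sym.
exists (last s p); split=> // [|b wb].
  by apply/negP => /domP/(_ p sp erefl); apply/negP.
apply: contraR; rewrite negb_or negbK => /andP[_ sb].
apply/eqP/esym; apply: (branch_uniq wa wb); apply: connect_trans sb.
by rewrite (sym_connect_sym (avoid_sym w)) avoid_connect.
Qed.

Lemma child_ex s w x : dom s w x -> w != x ->
  exists c, [/\ e w c, dom s w c & dom s c x].
Proof.
move=> /domP wx; have [p [sp up px]] := simple_path s x => wNx.
have wp := wx p sp px.
case/splitPl: wp sp up px => p1 [|c p2] p1w.
  by rewrite cats0 p1w => _ _ wE; rewrite wE eqxx in wNx.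
rewrite -cat_rcons => sp up px; exists c.
have cx : dom s c x.
  by rewrite -px path_dom // -cat_cons mem_cat -rcons_cons mem_rcons mem_head.
move: sp up; rewrite cat_path -cat_cons cat_uniq => /andP[spc _] /andP[uc _].
split=> //; first by move: spc; rewrite rcons_path p1w => /andP[].
have := path_dom spc uc (x := w); rewrite last_rcons; apply.
by rewrite -rcons_cons mem_rcons inE -p1w mem_last orbT.
Qed.

(** The path to w followed by the edge from w to c reaches c; a child b of w can lie
on it only as its end. *)
Lemma sibling_incomparable s w b c : e w b -> e w c -> dom s w b -> dom s b c ->
  b = c.
Proof.
move=> wb wc dwb /domP bc; have [p [sp up pw]] := simple_path s w.
have /bc : path e s (rcons p c) by rewrite rcons_path sp pw.
rewrite last_rcons => /(_ erefl); rewrite -rcons_cons mem_rcons inE.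
case/orP=> [/eqP //|bp]; have := path_dom sp up bp; rewrite pw => dbw.
by have bw : b = w by [apply: (@dom_anti s); rewrite dbw]; rewrite bw e_irr in wb.
Qed.

Lemma subtree_adj H u v : subtree e H -> adj H u v -> e u v /\ v \in H.1.
Proof.
case/and3P=> /andP[/andP[_ subE] /forall_inP ends] _ _ uv.
split; last by have /subsetP := ends _ uv; apply; rewrite set22.
have /imset2P[a b _ ab uvE] := subsetP subE _ uv.
have eab : e a b := ab.
have aNb : a != b by apply: contraTneq eab => ->; rewrite e_irr.
have: a \in [set u; v] by rewrite uvE set21.
have: b \in [set u; v] by rewrite uvE set22.
rewrite !inE => /orP[]/eqP bE /orP[]/eqP aE; move: eab aNb; rewrite aE bE ?eqxx //.
by move=> vu _; rewrite e_sym.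
Qed.

Lemma subtree_downset H s : subtree e H -> s \in H.1 -> downset (dom s) H.1.
Proof.
move=> subH sH; have /and3P[_ _ /forall_inP conn] := subH.
apply/downsetP => y x yH /domP xy.
have /forall_inP/(_ y yH)/connectP[p sp py] := conn s sH.
have [sp' /allP pH] : path e s p /\ all [in H.1] p.
  elim: p s sp {py sH xy} => //= v p IHp s /andP[/(subtree_adj subH)[-> vH] /IHp[-> ->]].
  by rewrite vH.
by have := xy p sp' (esym py); rewrite inE => /orP[/eqP->|/pH].
Qed.

Lemma downset_subtree (A : {set V}) s :
  s \in A -> downset (dom s) A -> subtree e (induced e A).
Proof.
move=> sA /downsetP dA; apply/and3P; split.
- apply/andP; split; last by apply/forall_inP => f; rewrite inE => /andP[].
  by rewrite /sub_graph subsetT; apply/subsetP => f; rewrite inE => /andP[].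
- by apply/set0Pn; exists s.
have adj_sym : symmetric (adj (induced e A)) by move=> x y; rewrite /adj setUC.
suff from_s y : y \in A -> connect (adj (induced e A)) s y.
  apply/forall_inP => x xA; apply/forall_inP => y yA.
  by apply: connect_trans (from_s y yA); rewrite (sym_connect_sym adj_sym) from_s.
move=> yA; have [p [sp up py]] := simple_path s y.
have pA x : x \in s :: p -> x \in A by move=> xp; apply: dA yA _; rewrite -py path_dom.
apply/connectP; exists p => //; elim: p s sp pA {up py sA dA} => //= v p IHp s.
case/andP=> sv vp pA; rewrite IHp // => [|x xp]; last by rewrite pA // inE xp orbT.
rewrite andbT /adj inE; apply/andP; split; first exact: imset2_f.
by apply/subsetP => x; rewrite !inE => /orP[]/eqP->; apply: pA; rewrite !inE eqxx ?orbT.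
Qed.

(** An edge of the tree joining two vertices of a subtree is the only simple path
between them, so it belongs to the subtree. *)
Lemma subtree_induced H : subtree e H -> H = induced e H.1.
Proof.
case: H => A E subH.
have adjE u v : adj (A, E) u v -> e u v by case/(subtree_adj subH).
case/and3P: subH => /andP[/andP[_ subE] /forall_inP ends] _ /forall_inP conn.
congr pair; apply/setP => f; rewrite inE; apply/idP/andP => [fE|[]].
  by rewrite (subsetP subE) // ends.
case/imset2P=> x y _ xy' -> /subsetP fA; have xy : e x y := xy'.
have /forall_inP/(_ y)/= := conn x (fA x (set21 _ _)).
rewrite fA ?set22 // => /(_ isT)/connectP[p0 xp0]; case/shortenP: xp0 => p xp up _ yE.
have : size p < 2.
  case: treeT => _ _ _ _ /(_ x p); apply; apply/andP; split => //=.
  by rewrite rcons_path (sub_path adjE xp) -yE e_sym.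
case: p xp yE {up} => [_ yE|z [|//]]; first by rewrite [y]yE e_irr in xy.
by rewrite /= andbT => xz ->.
Qed.

(** A vertex other than the root has one neighbour that is not above it, so degree
at most 2 means at most one child.  Two children are incomparable; and if there
is a single child, every vertex strictly above w is above that child, so that
the chain property descends from the child to w. *)
Lemma chain_iff_degree s (S : {set V}) : s \in S -> downset (dom s) S ->
  [forall w in ~: S, chain_above (dom s) w] = [forall w in ~: S, degree e w <= 2].
Proof.
move=> sS /downsetP dS; apply/forall_inP/forall_inP => [chains w wS|degs].
  have ws : w != s by apply: contraTneq wS => ->; rewrite inE negbK.
  have [a [wa _ below]] := parent_ex ws; have /chain_aboveP ch := chains w wS.
  rewrite /degree (cardsD1 a) inE wa add1n ltnS.
  rewrite leqNgt; apply/negP => /card_gt1P[b [c [+ + /negP]]].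
  rewrite !inE => /andP[ba wb] /andP[ca wc]; apply; apply/eqP.
  have [db dc] := (below b wb ba, below c wc ca).
  case/orP: (ch b c db dc) => [bc|cb]; last apply: esym.
    exact: sibling_incomparable wb wc db bc.
  exact: sibling_incomparable wc wb dc cb.
move=> w; have [n] := ubnP #|[set x | dom s w x]|; elim: n w => // n IHn w ltn wS.
have ws : w != s by apply: contraTneq wS => ->; rewrite inE negbK.
have [a [wa wNa _]] := parent_ex ws.
apply/chain_aboveP => x y wx wy.
have [<-|wNx] := eqVneq w x; first by rewrite wy.
have [<-|wNy] := eqVneq w y; first by rewrite wx orbT.
have [c [wc dwc cx]] := child_ex wx wNx; have [d [wd dwd dy]] := child_ex wy wNy.
have dE : d = c.
  apply/eqP; apply: contraLR (degs w wS) => dc; rewrite -ltnNge.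
  (* Otherwise w has the parent a and two children c, d as neighbours. *)
  apply: leq_trans (_ : #|[set a; d; c]| <= _).
    rewrite setUC cardsU1 cards2 !inE [c == d]eq_sym (negbTE dc) orbF.
    have -> : c != a by apply: contraNneq wNa => <-.
    by have -> : a != d by apply: contraNneq wNa => ->.
  by apply/subset_leq_card/subsetP => z; rewrite !inE -orbA => /or3P[]/eqP->.
rewrite dE in dy; apply: (chain_aboveP _ _ (IHn c _ _)) => //; last first.
  by rewrite inE; apply: contraL wS => cS; rewrite inE negbK; apply: dS dwc.
rewrite ltnS in ltn; apply: leq_trans ltn; apply/proper_card/properP; split.
  by apply/subsetP => z; rewrite !inE; apply: dom_trans.
exists w; rewrite !inE ?dom_refl //; apply: contraTN wc => cw.
by rewrite (@dom_anti s w c) ?e_irr // dwc.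
Qed.

Lemma sub_graph_refl (H : graph V) : sub_graph H H.
Proof. by rewrite /sub_graph !subxx. Qed.

(** A path as in the definition of limbs lies in a maximal one. *)
Lemma leaf_path_core P x : leaf_path e P -> x \in P.1 -> x \notin (core e).1.
Proof.
move=> pathP xP; rewrite inE negb_forall; apply/existsP.
(* This sum strictly increases along proper inclusions of graphs. *)
have [|Q /andP[pathQ PQ] Qmax] := @arg_maxnP _ P
    (fun Q => leaf_path e Q && sub_graph P Q) (fun Q => #|Q.1| + #|Q.2|).
  by rewrite pathP sub_graph_refl.
exists Q; rewrite negb_imply negbK (subsetP _ _ xP) ?andbT; last by case/andP: PQ.
apply/andP; split=> //; apply/forallP => Q'; apply/implyP => pathQ'.
apply/implyP => /andP[sub1 sub2].
have {Qmax} := Qmax Q'; rewrite pathQ' => /(_ _)/wrap[].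
  case/andP: PQ => PQ1 PQ2.
  by rewrite /sub_graph (subset_trans PQ1 sub1) (subset_trans PQ2 sub2).
move=> leQ; have [le1 le2] := (subset_leq_card sub1, subset_leq_card sub2).
have e1 : Q.1 == Q'.1.
  by rewrite eqEcard sub1 -(leq_add2r #|Q.2|) (leq_trans _ leQ) ?leq_add2l.
have e2 : Q.2 == Q'.2.
  by rewrite eqEcard sub2 -(leq_add2l #|Q.1|) (leq_trans _ leQ) ?leq_add2r.
by rewrite eq_sym; move: Q Q' e1 e2 {pathQ PQ pathQ' sub1 sub2 leQ le1 le2}
  => [? ?] [? ?] /= /eqP-> /eqP->.
Qed.

Lemma notin_core_degree x : x \notin (core e).1 -> degree e x <= 2.
Proof.
rewrite inE => /forallPn[P]; rewrite negb_imply negbK => /andP[/andP[]].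
case/and3P=> _ _ /forall_inP deg _ xP.
by case/orP: (deg x xP) => [lf|/eqP->//]; apply: leq_trans lf _.
Qed.

(** If all degrees outside S are at most 2, then everything above a vertex x outside
S is a chain with a top v.  The path from x to v stays outside S, so its inner
vertices have degree at most 2, and v is a leaf since a second neighbour would be
above v.  Hence x lies in a limb. *)
Lemma core_sub_iff s (S : {set V}) : s \in S -> downset (dom s) S ->
  ((core e).1 \subset S) = [forall w in ~: S, degree e w <= 2].
Proof.
move=> sS dS; apply/subsetP/idP => [coreS|degs].
  apply/forall_inP => w; rewrite inE => wS; apply: notin_core_degree.
  by apply: contra wS => /coreS.
move=> x; apply: contraTT => xS.
have xS' : x \in ~: S by rewrite inE.
have chains := degs; rewrite -(chain_iff_degree sS dS) in chains.
have [v [_ xv vmax]] :=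
  chain_max (@dom_refl s) (@dom_trans s) (forall_inP chains x xS') (in_setT x).
have [p [sp up pv]] := simple_path s v.
have xp := (domP _ _ _ xv) p sp pv.
case/splitPl: xp sp up pv => p1 p2 px sp up pv.
have above y : y \in x :: p2 -> dom s x y.
  move=> yp; have yv : dom s y v.
    rewrite -pv path_dom // -cat_cons mem_cat; move: yp; rewrite inE.
    by case/orP=> [/eqP->|->]; rewrite ?orbT // -px mem_last.
  case/splitPl: yp sp up => p3 p4 py; rewrite catA => sp up.
  rewrite -py -px -last_cat; apply: path_dom.
  - by move: sp; rewrite cat_path => /andP[].
  - by move: up; rewrite -cat_cons cat_uniq => /andP[].
  by rewrite -cat_cons mem_cat mem_last.
have notS y : dom s x y -> y \in ~: S.
  by move=> xy; rewrite inE; apply: contra xS => yS; apply: (downsetP _ _ dS) xy.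
apply: (@leaf_path_core (path_graph x p2)); last by rewrite inE mem_head.
have x_p2 : path e x p2 by move: sp; rewrite cat_path px => /andP[].
have u_p2 : uniq (x :: p2).
  move: up; rewrite -cat_cons cat_uniq => /and3P[_ /hasPn disj u2].
  by rewrite cons_uniq u2 andbT; apply/negP => /disj; rewrite -px mem_last.
have v_leaf : leaf e v.
  have vs : v != s by apply: contraTneq (notS v xv) => ->; rewrite inE negbK.
  have [a [va _ below]] := parent_ex vs.
  rewrite /leaf /degree -(cards1 a); apply/subset_leq_card/subsetP => b.
  rewrite !inE => vb; apply: contraTT vb => ba; apply/negP => vb.
  have dvb := below b vb ba.
  have bv : b = v.
    by apply: (@dom_anti s); rewrite dvb andbT vmax ?inE // (dom_trans xv).
  by rewrite bv e_irr in vb.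
apply/and3P; split.
- have ltn : size p2 < #|V| by move/card_uniqP: u_p2 => /= <-; apply: max_card.
  apply/existsP; exists (Ordinal ltn); apply/existsP; exists x.
  by apply/existsP; exists (in_tuple p2); rewrite u_p2 x_p2 eqxx.
- apply/exists_inP; exists v => //; rewrite inE -pv last_cat px; exact: mem_last.
apply/forall_inP => y; rewrite inE => /above/notS yS.
by have := forall_inP degs y yS; rewrite /leaf; case: ltngtP => // [|->]; rewrite ?orbT // ltnS => ->.
Qed.

(** A connected set containing the root holds a walk from the root to each of its
vertices, hence is a down-set; a down-set holds the whole simple path from the
root to each of its vertices, hence is connected. *)
Lemma subtrees_containingE S s : subtree e S -> s \in S.1 ->
  subtrees_containing e S = induced e @: downsets_containing (dom s) S.1.
Proof.
move=> subS sS; apply/setP => H; apply/idP/imsetP.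
  rewrite inE => /andP[subH /andP[SH _]]; exists H.1; last exact: subtree_induced.
  by rewrite inE SH subtree_downset // (subsetP SH).
case=> A; rewrite inE => /andP[SA dA] ->.
rewrite inE (downset_subtree (subsetP SA _ sS)) //.
rewrite (subtree_induced subS) /sub_graph SA /=.
by apply/subsetP => f; rewrite !inE => /andP[-> /subset_trans->].
Qed.

End Dominance.

(** * The density inequality *)

Local Open Scope ring_scope.

(** With |T| = n, |S| = k and N subtrees containing S, of total order R, the density exceeds 1/2 by
((R - k N) - (n N - R)) / (2 N (n - k)), where R - k N and n N - R count the
vertices outside S in these subtrees and the vertices outside them. *)
Lemma local_density_leqif (V : finType) (e : rel V) (S : graph V) s :
  is_tree e -> subtree e S -> S != whole e -> s \in S.1 ->
  let F := downsets_containing (dom e s) S.1 in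
  forall C, (\sum_(A in F) #|~: A| <= \sum_(A in F) #|A :\: S.1| ?= iff C)%N ->
  1 / 2%:R <= local_density e S ?= iff C.
Proof.
move=> treeT subS properS sS F C.
have inj : injective (induced e) by move=> A B [].
have NE : subtree_number e S = #|F|.
  by rewrite /subtree_number (subtrees_containingE treeT subS sS) card_imset.
have RE : subtree_order_sum e S = (\sum_(A in F) #|A|)%N.
  rewrite /subtree_order_sum (subtrees_containingE treeT subS sS) big_imset //.
  by move=> A B _ _; apply: inj.
rewrite /local_density /local_mean NE RE /graph_order cardsT.
have N_gt0 : (0 < #|F|)%N.
  apply/card_gt0P; exists S.1.
  by rewrite inE subxx subtree_downset.
have k_lt_n : (#|S.1| < #|V|)%N.
  rewrite -cardsT; apply: proper_card; rewrite properT.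
  apply: contraNneq properS => ST; rewrite (subtree_induced treeT subS) ST.
  apply/eqP; congr pair; apply/setP => f; rewrite inE subsetT andbT //.
have outE : (\sum_(A in F) #|~: A| + \sum_(A in F) #|A| = #|F| * #|V|)%N.
  rewrite -big_split -sum_nat_const; apply: eq_bigr => A _ /=.
  by rewrite addnC cardsC.
have restE : (\sum_(A in F) #|A :\: S.1| + #|F| * #|S.1| = \sum_(A in F) #|A|)%N.
  rewrite -sum_nat_const -big_split; apply: eq_bigr => A /=.
  by rewrite inE => /andP[SA _]; rewrite cardsDS // subnK ?subset_leq_card.
move: (\sum_(A in F) #|~: A|)%N outE => X outE.
move: (\sum_(A in F) #|A :\: S.1|)%N restE => Y restE.
move: (\sum_(A in F) #|A|)%N #|F| #|S.1| #|V| N_gt0 k_lt_n outE restE.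
move=> R N k n N_gt0 k_lt_n outE restE [].
rewrite -(ler_nat rat) -(eqr_nat rat) => leXY eqXY.
have neqs : (N%:R != 0 :> rat) /\ (n%:R - k%:R != 0 :> rat).
  by rewrite subr_eq0 !(eqr_nat, pnatr_eq0) -lt0n N_gt0 gtn_eqF.
have slack : (R%:R / N%:R - k%:R) / (n%:R - k%:R) =
    1 / 2%:R + (Y%:R - X%:R) / (2%:R * N%:R * (n%:R - k%:R)) :> rat.
  have {}outE : X%:R + R%:R = N%:R * n%:R :> rat by rewrite -natrD outE natrM.
  have {}restE : Y%:R + N%:R * k%:R = R%:R :> rat by rewrite -natrM -natrD restE.
  have -> : X%:R = N%:R * n%:R - R%:R :> rat by rewrite -outE addrK.
  have -> : Y%:R = R%:R - N%:R * k%:R :> rat by rewrite -restE addrK.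
  by case: neqs => N0 nk0; field; rewrite N0 nk0.
have pos : 0 < 2%:R * N%:R * (n%:R - k%:R) :> rat.
  by rewrite !mulr_gt0 ?subr_gt0 ?ltr_nat ?ltr0n.
split; rewrite slack.
  by rewrite lerDl divr_ge0 ?subr_ge0 // ltW.
rewrite -subr_eq0 opprD addrA subrr add0r oppr_eq0 mulf_eq0 invr_eq0 (gt_eqF pos) orbF.
by rewrite subr_eq0 eq_sym.
Qed.

Theorem theorem6p4 (V : finType) (e : rel V) (S : graph V)
    (treeT : is_tree e) (subtreeS : subtree e S) (properS : S != whole e) :
  1 / 2%:R <= local_density e S /\
  (local_density e S = 1 / 2%:R <-> sub_graph (core e) S).
Proof.
have /set0Pn[s sS] : S.1 != set0 by case/and3P: subtreeS.
have dS := subtree_downset treeT subtreeS sS.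
have [le_half eq_half] := local_density_leqif treeT subtreeS properS sS
  (missing_leqif_extra (@dom_refl _ e s) (@dom_anti _ _ treeT s)
    (@dom_trans _ e s) (@dom_forest _ _ treeT s) dS).
have core_sub : sub_graph (core e) S = ((core e).1 \subset S.1).
  rewrite (subtree_induced treeT subtreeS) /sub_graph /=.
  case: (boolP (_ \subset _)) => //= sub; apply/subsetP => f.
  by rewrite !inE => /andP[-> /subset_trans->].
split=> //; rewrite core_sub (core_sub_iff treeT sS dS).
rewrite -(chain_iff_degree treeT sS dS) -eq_half.
by split=> [->|/eqP].
Qed.
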